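(* Let $n\ge1$ and $\boldsymbol\lambda=(\lambda_1,\dots,\lambda_n)\in(\mathbb{F}_q^* )^n$. (i) Let $\chi=((\alpha_i)_{i=0}^n,(\beta_i)_{i=0}^n)$ be a character of $(\mathbb{F}_q^* )^{2(n+1)}$. If $\alpha_i\beta_i\ne\varepsilon$ for all $i=0,\dots,n$, then $$N(X_{F_D^n,\boldsymbol\lambda};\chi)=-\Big(\prod_{i=0}^nj(\alpha_i,\beta_i)\Big)F_D^{(n)}\left({\alpha_0;\alpha_1,\dots,\alpha_n\atop\overline{\beta_0};\overline{\beta_1},\dots,\overline{\beta_n}};\boldsymbol\lambda\right).$$ (ii) Let $\chi=((\alpha_i)_{i=0}^n,(\beta_i)_{i=1}^n,(\gamma_i)_{i=1}^n)$ be a character of $(\mathbb{F}_q^* )^{3n+1}$. If $\varepsilon\notin\{\alpha_0\cdots\alpha_n,\ \beta_i\gamma_i\ (i=1,\dots,n)\}$, then $$N(X_{F_A^n,\boldsymbol\lambda};\chi)=(-1)^nj(\alpha_0,\dots,\alpha_n)\Big(\prod_{i=1}^nj(\beta_i,\gamma_i)\Big)F_A^{(n)}\left({\alpha_0;\beta_1,\dots,\beta_n\atop\overline{\alpha_1},\dots,\overline{\alpha_n};\overline{\gamma_1},\dots,\overline{\gamma_n}};\boldsymbol\lambda\right).$$ (iii) Let $\chi=((\alpha_i)_{i=0}^n,(\beta_i)_{i=0}^n)$ be a character of $(\mathbb{F}_q^* )^{2(n+1)}$. If $\varepsilon\notin\{\alpha_0\cdots\alpha_n,\beta_0\cdots\beta_n\}$,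 then $$N(X_{F_C^n,\boldsymbol\lambda};\chi)=(-1)^nj(\alpha_0,\dots,\alpha_n)j(\beta_0,\dots,\beta_n)F_C^{(n)}\left({\alpha_0;\beta_0\atop\overline{\alpha_1},\dots,\overline{\alpha_n};\overline{\beta_1},\dots,\overline{\beta_n}};\boldsymbol\lambda\right).$$
   Context: $q$ is a power of a prime $p$, $N=q-1$, $\psi$ a fixed nontrivial additive character of $\mathbb{F}_q$. For multiplicative characters $\eta$ of $\mathbb{F}_q^*$: $\eta(0)=0$, $\overline\eta=\eta^{-1}$, $\varepsilon$ trivial, $\delta(\eta)=1$ iff $\eta=\varepsilon$. $g(\eta)=-\sum_{x\in\mathbb{F}_q^*}\psi(x)\eta(x)$, $g^\circ(\eta)=q^{\delta(\eta)}g(\eta)$, $j(\eta_1,\dots,\eta_r)=(-1)^{r-1}\sum_{x_i\in\mathbb{F}_q^*,\,\sum x_i=1}\prod\eta_i(x_i)$, $(\alpha)_\nu=g(\alpha\nu)/g(\alpha)$, $(\alpha)^\circ_\nu=g^\circ(\alpha\nu)/g^\circ(\alpha)$. All sums below run over $\nu_1,\dots,\nu_n$ characters of $\mathbb{F}_q^*$: $F_D^{(n)}\left({\alpha;\beta_1,\dots,\beta_n\atop\gamma;\delta_1,\dots,\delta_n};\boldsymbol\lambda\right)=\frac1{(1-q)^n}\sum\frac{(\alpha)_{\nu_1\cdots\nu_n}\prod_i(\beta_i)_{\nu_i}}{(\gamma)^\circ_{\nu_1\cdots\nu_n}\prod_i(\delta_i)^\circ_{\nu_i}}\prod_i\nu_i(\lambda_i)$;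 $F_A^{(n)}\left({\alpha;\beta_1,\dots,\beta_n\atop\gamma_1,\dots,\gamma_n;\delta_1,\dots,\delta_n};\boldsymbol\lambda\right)=\frac1{(1-q)^n}\sum\frac{(\alpha)_{\nu_1\cdots\nu_n}\prod_i(\beta_i)_{\nu_i}}{\prod_i(\gamma_i)^\circ_{\nu_i}(\delta_i)^\circ_{\nu_i}}\prod_i\nu_i(\lambda_i)$; $F_C^{(n)}\left({\alpha;\beta\atop\gamma_1,\dots,\gamma_n;\delta_1,\dots,\delta_n};\boldsymbol\lambda\right)=\frac1{(1-q)^n}\sum\frac{(\alpha)_{\nu_1\cdots\nu_n}(\beta)_{\nu_1\cdots\nu_n}}{\prod_i(\gamma_i)^\circ_{\nu_i}(\delta_i)^\circ_{\nu_i}}\prod_i\nu_i(\lambda_i)$. Varieties over $\mathbb{F}_q$: $X_{F_D^n,\boldsymbol\lambda}$ in coordinates $(x_0,\dots,x_n,y_0,\dots,y_n)$: $x_i^N+y_i^N=1$ ($0\le i\le n$), $\lambda_ix_0^Nx_i^N=y_0^Ny_i^N$ ($1\le i\le n$), $\prod_{i=0}^nx_iy_i\ne0$. $X_{F_A^n,\boldsymbol\lambda}$ in coordinates $(x_0,\dots,x_n,y_1,\dots,y_n,z_1,\dots,z_n)$: $x_0^N+\dots+x_n^N=1$, $y_i^N+z_i^N=1$, $\lambda_ix_0^Ny_i^N=x_i^Nz_i^N$ ($1\le i\le n$), $\prod x_i\prod y_iz_i\ne0$. $X_{F_C^n,\boldsymbol\lambda}$ in coordinates $(x_0,\dots,x_n,y_0,\dots,y_n)$: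 $\sum_ix_i^N=1$, $\sum_iy_i^N=1$, $\lambda_ix_0^Ny_0^N=x_i^Ny_i^N$ ($1\le i\le n$), $\prod x_iy_i\ne0$. The tori $(\mathbb{F}_q^* )^{2n+2}$, $(\mathbb{F}_q^* )^{3n+1}$, $(\mathbb{F}_q^* )^{2n+2}$ act by coordinatewise multiplication, in the listed coordinate order, and the characters are listed in the same order (e.g. $\chi(\xi)=\prod\alpha_i(\xi_{x_i})\prod\beta_i(\xi_{y_i})\cdots$). For a variety $X$ over $\mathbb{F}_q$ with an action of a finite abelian group $G$ and a character $\chi$, $N(X;\chi)=\frac1{\#G}\sum_{g\in G}\chi(g)\#\{P\in X(\overline{\mathbb{F}}_q):\mathrm{Frob}(P)=g\cdot P\}$. *)

(* Defs.v *)
From HB Require Import structures.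
From mathcomp Require Import all_boot all_order all_algebra all_fingroup.
From mathcomp Require Import all_solvable all_field all_character finmap.
From mathcomp Require Import boolp classical_sets cardinality.

Set Implicit Arguments.
Unset Strict Implicit.
Unset Printing Implicit Defensive.

Import GRing.Theory Num.Theory.
Local Open Scope ring_scope.

(* A character of F^* is an element of [mcfun F] satisfying [linear_char]; in
   the ring [mcfun F] the product is the pointwise product of characters, 1 is
   the trivial character and, on linear characters, ^-1 is the inverse
   character. *)
Notation mcfun F := 'CF([set: {unit F}]%G).

(* As F^* is abelian, its irreducible characters 'chi_i are its linear
   characters, each listed once; sums over all characters are sums over this
   index type. *)
Notation mchar_index F := (Iirr [set: {unit F}]%G).

Section GaussSums.

Variables (F : finFieldType) (psi : 'CF([set: F]%G)).

Local Notation q := (#|F|%:R : algC).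

Definition mchar_ext (eta : mcfun F) (x : F) : algC :=
  if insub x : option {unit F} is Some u then eta u else 0.

Definition gauss (eta : mcfun F) : algC :=
  - \sum_(x : {unit F}) psi (val x) * eta x.

Definition gausso (eta : mcfun F) : algC := q ^+ (eta == 1) * gauss eta.

Definition jacobi (r : nat) (eta : 'I_r -> mcfun F) : algC :=
  (-1) ^+ r.-1 *
  \sum_(x : {ffun 'I_r -> {unit F}} | \sum_i val (x i) == 1 :> F)
     \prod_i eta i (x i).

Definition jacobi2 (eta1 eta2 : mcfun F) : algC :=
  jacobi (tnth [tuple eta1; eta2]).

Definition poch (alpha nu : mcfun F) : algC := gauss (alpha * nu) / gauss alpha.

Definition pocho (alpha nu : mcfun F) : algC :=
  gausso (alpha * nu) / gausso alpha.

Variable n : nat.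

Definition lauricellaD (alpha : mcfun F) (beta : 'I_n -> mcfun F)
    (gamma : mcfun F) (delta : 'I_n -> mcfun F) (lam : 'I_n -> F) : algC :=
  ((1 - q) ^+ n)^-1 *
  \sum_(k : {ffun 'I_n -> mchar_index F})
    let nu (i : 'I_n) : mcfun F := 'chi_(k i) in
    (poch alpha (\prod_i nu i) * \prod_i poch (beta i) (nu i))
    / (pocho gamma (\prod_i nu i) * \prod_i pocho (delta i) (nu i))
    * \prod_i mchar_ext (nu i) (lam i).

Definition lauricellaA (alpha : mcfun F) (beta gamma delta : 'I_n -> mcfun F)
    (lam : 'I_n -> F) : algC :=
  ((1 - q) ^+ n)^-1 *
  \sum_(k : {ffun 'I_n -> mchar_index F})
    let nu (i : 'I_n) : mcfun F := 'chi_(k i) in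
    (poch alpha (\prod_i nu i) * \prod_i poch (beta i) (nu i))
    / (\prod_i (pocho (gamma i) (nu i) * pocho (delta i) (nu i)))
    * \prod_i mchar_ext (nu i) (lam i).

Definition lauricellaC (alpha beta : mcfun F) (gamma delta : 'I_n -> mcfun F)
    (lam : 'I_n -> F) : algC :=
  ((1 - q) ^+ n)^-1 *
  \sum_(k : {ffun 'I_n -> mchar_index F})
    let nu (i : 'I_n) : mcfun F := 'chi_(k i) in
    (poch alpha (\prod_i nu i) * poch beta (\prod_i nu i))
    / (\prod_i (pocho (gamma i) (nu i) * pocho (delta i) (nu i)))
    * \prod_i mchar_ext (nu i) (lam i).

End GaussSums.

(* [X] is the set of geometric points, and [G] the (underlying finite type of
   the) group acting through [act]. [fset_set] is the empty finite set on
   infinite sets; [finite_torus_fixed] below shows that this never occurs for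
   the tori used here. *)
Definition Nchar (T : choiceType) (G : finType) (frob : T -> T)
    (act : G -> T -> T) (X : set T) (chi : G -> algC) : algC :=
  #|G|%:R^-1 *
  \sum_(g : G)
    chi g * #|` fset_set [set P | X P /\ frob P = act g P]%classic |%:R.

Section Varieties.

Variables (F : finFieldType) (K : closedFieldType) (iota : {rmorphism F -> K}).

Section Torus.

Variable I : finType.

Definition frobenius (P : {ffun I -> K}) : {ffun I -> K} :=
  [ffun c => P c ^+ #|F|].

Definition torus_act (xi : {ffun I -> {unit F}}) (P : {ffun I -> K}) :
  {ffun I -> K} := [ffun c => iota (val (xi c)) * P c].

Definition torus_char (chi : I -> mcfun F) (xi : {ffun I -> {unit F}}) : algC :=
  \prod_c chi c (xi c).

Definition torusN (X : set {ffun I -> K}) (chi : I -> mcfun F) : algC :=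
  Nchar frobenius torus_act X (torus_char chi).

Lemma finite_torus_fixed (X : set {ffun I -> K}) (xi : {ffun I -> {unit F}}) :
  finite_set [set P | X P /\ frobenius P = torus_act xi P]%classic.
Proof.
pose p : {poly K} := \prod_(c : I) ('X^#|F| - iota (val (xi c)) *: 'X).
have p_neq0 : p != 0.
  apply/prodf_neq0 => c _; apply/negP => /eqP /(congr1 (coefp #|F|)) /=.
  have /negPf q_neq1 : #|F| != 1%N by rewrite neq_ltn finNzRing_gt1 orbT.
  rewrite coefB coefXn coefZ coefX eqxx q_neq1 mulr0 subr0 coef0.
  by move/eqP; rewrite oner_eq0.
have [L p_split] := closed_field_poly_normal p.
pose f (t : {ffun I -> seq_sub L}) : {ffun I -> K} := [ffun c => val (t c)].
apply: (@sub_finite_set _ _ (f @` setT)%classic); last first.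
  by apply: finite_image; exact: finite_finset.
move=> P [_ /ffunP fixP].
have memL c : P c \in L.
  rewrite -root_prod_XsubC -(@rootZ _ _ (lead_coef p)) ?lead_coef_eq0 //.
  rewrite -p_split /p (bigD1 c) //= rootM; apply/orP; left.
  by move: (fixP c); rewrite !ffunE rootE !hornerE => ->; rewrite subrr.
exists [ffun c => SeqSub (memL c)] => //.
by apply/ffunP => c; rewrite !ffunE.
Qed.

End Torus.

Variables (n : nat) (lam : 'I_n -> F).

Local Notation N := #|F|.-1.
(* i : 'I_n stands for the index i + 1 in 1, ..., n. *)
Local Notation s i := (lift ord0 i).

Definition XFD : set {ffun 'I_n.+1 + 'I_n.+1 -> K} :=
  [set P | let x i := P (inl i) in let y i := P (inr i) in
    [/\ forall i, x i ^+ N + y i ^+ N = 1,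
        forall i : 'I_n, iota (lam i) * x ord0 ^+ N * x (s i) ^+ N
                         = y ord0 ^+ N * y (s i) ^+ N
      & \prod_i (x i * y i) != 0]]%classic.

Definition XFA : set {ffun 'I_n.+1 + ('I_n + 'I_n) -> K} :=
  [set P | let x i := P (inl i) in
           let y i := P (inr (inl i)) in let z i := P (inr (inr i)) in
    [/\ \sum_i x i ^+ N = 1,
        forall i, y i ^+ N + z i ^+ N = 1,
        forall i : 'I_n, iota (lam i) * x ord0 ^+ N * y i ^+ N
                         = x (s i) ^+ N * z i ^+ N
      & (\prod_i x i) * \prod_i (y i * z i) != 0]]%classic.

Definition XFC : set {ffun 'I_n.+1 + 'I_n.+1 -> K} :=
  [set P | let x i := P (inl i) in let y i := P (inr i) in
    [/\ \sum_i x i ^+ N = 1,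
        \sum_i y i ^+ N = 1,
        forall i : 'I_n, iota (lam i) * x ord0 ^+ N * y ord0 ^+ N
                         = x (s i) ^+ N * y (s i) ^+ N
      & \prod_i (x i * y i) != 0]]%classic.

End Varieties.

Definition sumfun (A B T : Type) (f : A -> T) (g : B -> T) (c : A + B) : T :=
  match c with inl a => f a | inr b => g b end.

(* Main.v *)
(* A point with nonzero coordinates satisfies [Frob P = xi . P] iff its
   coordinates are (q-1)-th roots of those of [xi]; the equations of the three
   varieties thus become equations on [xi], and the admissible [P] form a torsor
   under the torus, so [N(X; chi)] is the sum of [chi] over the rational points
   [xi] of the base. Orthogonality of characters expands each equation carrying
   [lambda_i] into a sum over [nu_i], and what remains factors into Jacobi sums
   of the characters twisted by the [nu_i]. Since the products of these
   characters are unchanged by the twists and nontrivial, the Jacobi sums are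
   quotients of Gauss sums, and the reflection formula
   [g(eta) go(eta^-1) = q eta(-1)] moves the factors twisted by [nu_i^-1] to the
   denominators; the signs [nu_i(-1)] cancel in pairs. *)
Require Import Defs.
From HB Require Import structures.
From mathcomp Require Import all_boot all_order all_algebra all_fingroup.
From mathcomp Require Import all_solvable all_field all_character finmap ring.
From mathcomp Require Import boolp classical_sets cardinality.

Set Implicit Arguments.
Unset Strict Implicit.
Unset Printing Implicit Defensive.

Import GRing.Theory Num.Theory.
Local Open Scope ring_scope.

(** * Linear characters of a finite group: values, inverses and sums *)

Section LinearCharacters.

Variable gT : finGroupType.
Implicit Types chi : 'CF([set: gT]%G).

Lemma lin_charMT chi : chi \is a linear_char ->
  {morph chi : x y / (x * y)%g >-> x * y}.
Proof. by move=> chiL x y; rewrite (lin_charM chiL) ?inE. Qed.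

Lemma lin_charVT chi (x : gT) : chi \is a linear_char ->
  chi (x^-1)%g = (chi x)^-1.
Proof. by move=> chiL; rewrite (lin_charV chiL) ?inE. Qed.

Lemma lin_char_neq0T chi (x : gT) : chi \is a linear_char -> chi x != 0.
Proof. by move=> chiL; rewrite (lin_char_neq0 chiL) ?inE. Qed.

(** The ring inverse of a linear character is its complex conjugate, and a linear character times
    its conjugate is the constant 1. *)
Lemma lin_char_invE chi (x : gT) : chi \is a linear_char ->
  chi^-1 x = (chi x)^-1.
Proof.
move=> chiL; apply: (mulfI (lin_char_neq0T x chiL)).
rewrite divff ?lin_char_neq0T //.
have <- : (chi * chi^-1) x = chi x * chi^-1 x by rewrite cfunE.
by rewrite invr_lin_char // mul_conjC_lin_char // cfun1E inE.
Qed.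

Lemma lin_char_divrr chi : chi \is a linear_char -> chi / chi = 1.
Proof. by move=> chiL; rewrite invr_lin_char // mul_conjC_lin_char. Qed.

(** If [chi x] differs from 1 for some [x], translating the summation variable by [x] multiplies the
    sum by [chi x] without changing it, so the sum is 0. *)
Lemma sum_lin_char chi : chi \is a linear_char ->
  \sum_x chi x = #|gT|%:R *+ (chi == 1).
Proof.
move=> chiL; have [->|chi_neq1] := eqVneq chi 1.
  under eq_bigr => x _ do rewrite cfun1E inE.
  by rewrite sumr_const.
have [x chix_neq1] : exists x, chi x != 1.
  apply/existsP; apply: contraNT chi_neq1; rewrite negb_exists => /forallP chi1.
  apply/eqP/cfunP => x; rewrite cfun1E inE.
  by apply/eqP; move: (chi1 x); rewrite negbK.
rewrite -subr_eq0 in chix_neq1.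
apply: (mulfI chix_neq1); rewrite mulr0n mulr0; apply/eqP.
rewrite mulrBl mul1r mulr_sumr subr_eq0 [X in _ == X](reindex_inj (mulgI x)).
by apply/eqP; apply: eq_bigr => y _; rewrite lin_charMT.
Qed.

End LinearCharacters.

(** * Characters of the unit group, orthogonality, and the element -1 *)

Section MultiplicativeCharacters.

Variable F : finFieldType.
Local Notation U := {unit F}.
Implicit Types (u v : U) (eta : mcfun F).

Lemma card_unit_neq0 : #|{: U}|%:R != 0 :> algC.
Proof. by rewrite pnatr_eq0 -lt0n; apply/card_gt0P; exists 1%g. Qed.

Lemma irr_unit_lin (i : mchar_index F) : 'chi_i \is a linear_char.
Proof.
by move: i; apply/char_abelianP; apply/cyclic_abelian/field_unit_group_cyclic.
Qed.

(** The regular character is supported at the identity and contains each irreducible character with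
    multiplicity its degree, which is 1 here. *)
Lemma sum_irr_unit u :
  \sum_(i : mchar_index F) 'chi_i u = #|{: U}|%:R *+ (u == 1%g).
Proof.
have := cfRegE [set: U]%G u; rewrite cfReg_sum sum_cfunE cardsT => <-.
by apply: eq_bigr => i _; rewrite cfunE (lin_char1 (irr_unit_lin i)) mul1r.
Qed.

(** Each condition [u i t = 1] is detected by averaging all characters at [u i t]; the product over
    [i] of these averages is distributed into one sum over families [k]. Only [C] remains as a
    constraint on [t]. *)
Lemma sum_char_expansion (I T : finType) (C : pred T)
    (u : I -> T -> U) (f : T -> algC) :
  \sum_(t | C t && [forall i, u i t == 1%g]) f t =
  #|{: U}|%:R ^- #|I| * \sum_(k : {ffun I -> mchar_index F})
     \sum_(t | C t) f t * \prod_i 'chi_(k i) (u i t).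
Proof.
rewrite exchange_big mulr_sumr big_mkcondr; apply: eq_bigr => t _ /=.
rewrite -mulr_sumr -(bigA_distr_bigA (fun i j => 'chi_j (u i t))) /=.
under eq_bigr => i _ do rewrite sum_irr_unit -mulr_natr.
rewrite big_split prodr_const /= mulrCA mulKf ?expf_neq0 ?card_unit_neq0 //.
case: forallP => [u1|/forallP].
  by rewrite big1 ?mulr1 // => i _; rewrite u1.
rewrite negb_forall => /existsP[i /negPf ui].
by rewrite (bigD1 i) //= ui mul0r mulr0.
Qed.

Definition unitN1 : U := FinRing.unit F (unitrN1 F).

Lemma lin_char_unitN1V eta : eta \is a linear_char ->
  (eta unitN1)^-1 = eta unitN1.
Proof.
move=> etaL; rewrite -lin_charVT //; congr (eta _); apply: val_inj.
by rewrite /= invrN1.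
Qed.

Lemma lin_char_unitN1_sqr eta : eta \is a linear_char ->
  eta unitN1 * eta unitN1 = 1.
Proof.
by move=> eL; rewrite -{1}lin_char_unitN1V // mulVf ?lin_char_neq0T.
Qed.

Lemma mchar_extE eta (x : F) (x_unit : x \is a GRing.unit) :
  mchar_ext eta x = eta (FinRing.unit F x_unit).
Proof. by rewrite /mchar_ext insubT. Qed.

End MultiplicativeCharacters.

(** * Gauss sums and the reflection formula *)

Section GaussAndJacobiSums.

Variables (F : finFieldType) (psi : 'CF([set: F]%G)).
Hypotheses (psi_lin : psi \is a linear_char) (psi_neq1 : psi != 1).
Local Notation U := {unit F}.
Local Notation q := (#|F|%:R : algC).
Local Notation g := (gauss psi).
Local Notation go := (gausso psi).
Implicit Types eta alpha beta nu : mcfun F.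

Lemma psiD x y : psi (x + y) = psi x * psi y.
Proof. exact: lin_charMT. Qed.

Lemma psi0 : psi 0 = 1.
Proof. exact: lin_char1. Qed.

Lemma q_neq0 : q != 0.
Proof. by rewrite pnatr_eq0 -lt0n; apply/card_gt0P; exists 0. Qed.

Lemma sum_unit (V : zmodType) (f : F -> V) :
  \sum_(u : U) f (val u) = \sum_x f x - f 0.
Proof.
rewrite [X in X - _](bigD1 0) //= addrAC subrr add0r.
rewrite (reindex_omap (val : U -> F) insub) /=; last first.
  by move=> x x_neq0; rewrite insubT ?unitfE //.
by apply: eq_bigl => u; rewrite valK eqxx andbT -unitfE (valP u).
Qed.

Lemma sum_psi : \sum_x psi x = 0.
Proof. by rewrite sum_lin_char // (negPf psi_neq1). Qed.

(** Over all of [F] the sum is [q] or 0 by orthogonality for [psi]; the -1 removes the term at 0. *)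
Lemma sum_unit_psiM (a : F) :
  \sum_(u : U) psi (a * val u) = q *+ (a == 0) - 1.
Proof.
rewrite (sum_unit (fun x => psi (a * x))) mulr0 psi0; congr (_ - _).
have [->|a_neq0] := eqVneq a 0.
  by under eq_bigr => x _ do rewrite mul0r psi0; rewrite sumr_const.
by rewrite mulr0n -[RHS]sum_psi [RHS](reindex_inj (mulfI a_neq0)).
Qed.

Lemma sum_unit_char eta : eta \is a linear_char ->
  \sum_(u : U) eta u = (q - 1) *+ (eta == 1).
Proof.
move=> /sum_lin_char ->; congr (_ *+ _).
have := sum_unit (fun=> 1 : algC); rewrite !sumr_const => ->.
by [].
Qed.

(* Substitute [x = t y] in the double sum and sum over [y] first. *)
Lemma gauss_mulV eta : eta \is a linear_char ->
  g eta * g eta^-1 = q * eta (unitN1 F) - (q - 1) *+ (eta == 1).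
Proof.
move=> etaL; rewrite /gauss mulrNN mulr_sumr.
under eq_bigr => y _.
  rewrite (reindex_inj (mulIg y)) mulr_suml /=.
  under eq_bigr => t _.
    rewrite lin_charMT // lin_char_invE //.
    have -> : psi (val t * val y) * (eta t * eta y) * (psi (val y) / eta y)
        = eta t * psi ((val t + 1) * val y).
      rewrite mulrDl mul1r psiD.
      rewrite -!mulrA [in RHS]mulrCA; congr (_ * _); congr (_ * _).
      by rewrite mulrCA mulfV ?mulr1 // lin_char_neq0T.
    over.
  over.
rewrite exchange_big /=.
under eq_bigr => t _ do rewrite -mulr_sumr sum_unit_psiM mulrBr mulr1.
rewrite sumrB sum_unit_char //; congr (_ - _).
(* The inner sum carries the term [q] only where [t + 1] vanishes, that is at [t = -1]. *)
rewrite (bigD1 (unitN1 F)) //= addNr eqxx mulr1n mulrC big1 ?addr0 //.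
move=> t; rewrite -(inj_eq val_inj) /= => /negPf tN1.
by rewrite addr_eq0 tN1 mulr0.
Qed.

Lemma gauss1 : g 1 = 1.
Proof.
rewrite /gauss; under eq_bigr => u _ do rewrite cfun1E inE mulr1 -[val u]mul1r.
by rewrite sum_unit_psiM oner_eq0 sub0r opprK.
Qed.

(** The factor [q] built into [gausso] at the trivial character is what makes one formula cover both
    cases: there [g 1 = 1] and [go 1 = q]. *)
Lemma gauss_reflection eta : eta \is a linear_char ->
  g eta * go eta^-1 = q * eta (unitN1 F).
Proof.
move=> etaL; rewrite /gausso invr_eq1 mulrCA.
have [->|eta_neq1] := eqVneq eta 1.
  by rewrite invr1 gauss1 !mulr1 cfun1E inE mulr1.
by rewrite mul1r gauss_mulV // (negPf eta_neq1) subr0.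
Qed.

(** The right-hand side of the reflection formula is nonzero. *)
Lemma gauss_neq0 eta : eta \is a linear_char -> g eta != 0.
Proof.
move=> etaL; apply: contraTneq (q_neq0) => g0.
have /eqP := gauss_reflection etaL; rewrite g0 mul0r eq_sym mulf_eq0.
by rewrite (negPf (lin_char_neq0T _ etaL)) orbF negbK.
Qed.

Lemma gausso_neq0 eta : eta \is a linear_char -> go eta != 0.
Proof. by move=> etaL; rewrite mulf_neq0 ?gauss_neq0 ?expf_neq0 ?q_neq0. Qed.

(** Reflection is applied to [beta / nu] and to [beta]. In the quotient [q] and [beta(-1)] cancel,
    leaving [nu(-1)], which is its own inverse. This is how a twist by [nu^-1] becomes a Pochhammer
    symbol in a denominator. *)
Lemma gauss_divr beta nu : beta \is a linear_char -> nu \is a linear_char ->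
  g (beta * nu^-1) = g beta * (nu (unitN1 F) / pocho psi beta^-1 nu).
Proof.
move=> bL nL; have bnL : beta / nu \is a linear_char by rewrite rpred_div.
have bVL : beta^-1 \is a linear_char by rewrite rpredV.
have bnVL : beta^-1 * nu \is a linear_char by rewrite rpredM.
rewrite /pocho invf_div.
apply: (mulIf (gausso_neq0 bnVL)).
rewrite -!mulrA mulVf ?gausso_neq0 // mulr1.
have -> : beta^-1 * nu = (beta / nu)^-1.
  by apply/cfunP => u; rewrite !(cfunE, lin_char_invE) // invfM invrK.
rewrite gauss_reflection // mulrCA gauss_reflection // !cfunE lin_char_invE //.
by rewrite lin_char_unitN1V // mulrA mulrC.
Qed.

(** The unsigned Jacobi sum over the hyperplane of level [t]; a general level is needed to sort a
    product of Gauss sums by the sum of its variables. *)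
Definition jsum r (eta : 'I_r -> mcfun F) (t : F) : algC :=
  \sum_(x : {ffun 'I_r -> U} | \sum_i val (x i) == t) \prod_i eta i (x i).

Lemma jacobiE r (eta : 'I_r -> mcfun F) :
  jacobi eta = (-1) ^+ r.-1 * jsum eta 1.
Proof. by []. Qed.

(** * Jacobi sums as quotients of Gauss sums *)

Section Jsum.

Variables (r : nat) (eta : 'I_r -> mcfun F).
Hypothesis etaL : forall i, eta i \is a linear_char.

(** Scaling all variables by [u] maps the hyperplane of level [t] bijectively to that of level
    [u t]. *)
Lemma jsumZ (u : U) (t : F) :
  jsum eta (val u * t) = (\prod_i eta i) u * jsum eta t.
Proof.
pose h (v : U) (x : {ffun 'I_r -> U}) := [ffun i => (v * x i)%g].
have hK v : cancel (h v) (h v^-1%g).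
  by move=> x; apply/ffunP => i; rewrite !ffunE mulKg.
rewrite /jsum (reindex_inj (can_inj (hK u))) mulr_sumr.
apply: eq_big => [x|x _].
  rewrite -[RHS](inj_eq (mulfI (_ : val u != 0))) ?mulr_sumr; last first.
    by rewrite -unitfE (valP u).
  by under eq_bigr => i _ do rewrite ffunE.
rewrite prod_cfunE ?inE // -big_split; apply: eq_bigr => i _ /=.
by rewrite ffunE lin_charMT.
Qed.

Hypothesis prod_eta_neq1 : \prod_i eta i != 1.

(** The product of Gauss sums is expanded and grouped by the sum [t] of the variables. Level 0
    contributes nothing, and homogeneity reduces every other level to level 1, leaving the Gauss sum
    of the product character. *)
Lemma prod_gauss : \prod_i g (eta i) = jacobi eta * g (\prod_i eta i).
Proof.
have etaPL : \prod_i eta i \is a linear_char by rewrite rpred_prod.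
(* Level 0 is fixed by scaling, so [jsum eta 0] is unchanged when multiplied by any value of the
   product character; summing over [u] kills it, as that character is nontrivial. *)
have jsum0 : jsum eta 0 = 0.
  have : \sum_(u : U) (\prod_i eta i) u * jsum eta 0 =
         \sum_(u : U) jsum eta 0.
    by apply: eq_bigr => u _; rewrite -jsumZ mulr0.
  rewrite -mulr_suml sum_lin_char // (negPf prod_eta_neq1) mul0r sumr_const.
  move/esym/eqP; rewrite -mulr_natr mulf_eq0 (negPf (card_unit_neq0 F)) orbF.
  by move/eqP.
(* An empty product would be trivial. Positivity of [r] is what makes the exponent [r.-1] in the
   Jacobi sum a true predecessor. *)
have r_gt0 : (0 < r)%N.
  rewrite lt0n; apply: contraNneq prod_eta_neq1 => r0.
  apply/eqP; apply: big1 => i _.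
  by suff: false by []; rewrite -(ltn0 i) -r0 ltn_ord.
have signE : (-1) ^+ r = - (-1) ^+ r.-1 :> algC.
  by rewrite -{1}(prednK r_gt0) exprS mulN1r.
rewrite /gauss jacobiE mulrN; under eq_bigr => i _ do rewrite -mulN1r.
rewrite big_split prodr_const card_ord /= signE mulNr -mulrA.
congr (- (_ * _)).
rewrite (bigA_distr_bigA (fun i x => psi (val x) * eta i x)) /=.
rewrite (partition_big (fun x : {ffun 'I_r -> U} => \sum_i val (x i))
  xpredT) //=.
have -> : \sum_(t : F) \sum_(x : {ffun 'I_r -> U} | \sum_i val (x i) == t)
    \prod_i (psi (val (x i)) * eta i (x i)) = \sum_(t : F) psi t * jsum eta t.
  apply: eq_bigr => t _; rewrite mulr_sumr; apply: eq_bigr => x /eqP <-.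
  rewrite big_split (big_morph psi psiD psi0) //.
have := sum_unit (fun t => psi t * jsum eta t).
rewrite jsum0 mulr0 subr0 => <-; rewrite mulr_sumr; apply: eq_bigr => u _.
by have := jsumZ u 1; rewrite mulr1 => ->; rewrite mulrA mulrC.
Qed.

Lemma jacobi_gauss : jacobi eta = \prod_i g (eta i) / g (\prod_i eta i).
Proof.
have PL : \prod_i eta i \is a linear_char by rewrite rpred_prod.
by rewrite prod_gauss mulfK ?gauss_neq0.
Qed.

End Jsum.

Lemma jacobi2_gauss alpha beta : alpha \is a linear_char ->
  beta \is a linear_char -> alpha * beta != 1 ->
  jacobi2 alpha beta = g alpha * g beta / g (alpha * beta).
Proof.
move=> aL bL ab; have := @jacobi_gauss 2 (tnth [tuple alpha; beta]).
rewrite -/(jacobi2 alpha beta) !big_ord_recl !big_ord0 !mulr1; apply=> //.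
by move=> i; rewrite (tnth_nth 0); case: i => [[|[|]]].
Qed.

Lemma jacobi2E alpha beta : jacobi2 alpha beta =
  - \sum_(x : U * U | val x.1 + val x.2 == 1) alpha x.1 * beta x.2.
Proof.
rewrite /jacobi2 /jacobi expr1 mulN1r; congr (- _).
pose h (x : U * U) : {ffun 'I_2 -> U} :=
  [ffun i => if i == 0 then x.1 else x.2].
rewrite (reindex h) /=; last first.
  exists (fun f : {ffun 'I_2 -> U} => (f 0, f 1)) => [[x y]|f] _.
    by rewrite !ffunE.
  apply/ffunP => i; rewrite ffunE; case: i => [[|[|]]] //= ip;
    by congr (f _); exact: val_inj.
by apply: eq_big => x; rewrite !big_ord_recl !big_ord0 ?addr0 ?mulr1 !ffunE.
Qed.

(** Opposite twists leave the product [alpha * beta] unchanged, so only the two Gauss sums in the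
    numerator move. *)
Lemma jacobi2_twist alpha beta nu : alpha \is a linear_char ->
  beta \is a linear_char -> nu \is a linear_char -> alpha * beta != 1 ->
  jacobi2 (alpha * nu) (beta * nu^-1) =
  jacobi2 alpha beta *
    (poch psi alpha nu * (nu (unitN1 F) / pocho psi beta^-1 nu)).
Proof.
move=> aL bL nL ab.
have abE : alpha * nu * (beta * nu^-1) = alpha * beta.
  by rewrite mulrACA lin_char_divrr // mulr1.
rewrite !jacobi2_gauss ?abE ?rpredM ?rpredV // gauss_divr // /poch.
move: (pocho _ _ _)^-1 => p.
field; rewrite ?gauss_neq0 ?rpredM //=.
Qed.

Lemma prod_jacobi2_twist (I : finType) (alpha beta nu : I -> mcfun F) :
  (forall i, alpha i \is a linear_char) ->
  (forall i, beta i \is a linear_char) ->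
  (forall i, nu i \is a linear_char) -> (forall i, alpha i * beta i != 1) ->
  \prod_i - jacobi2 (alpha i * nu i) (beta i * (nu i)^-1) =
  (-1) ^+ #|I| * (\prod_i jacobi2 (alpha i) (beta i) *
    (\prod_i poch psi (alpha i) (nu i) *
     \prod_i (nu i (unitN1 F) / pocho psi (beta i)^-1 (nu i)))).
Proof.
move=> aL bL nL ab; rewrite -prodr_const -!big_split; apply: eq_bigr => i _ /=.
by rewrite jacobi2_twist // mulN1r.
Qed.

End GaussAndJacobiSums.

(** * From twisted Frobenius fixed points to character sums over rational points *)

Section TorusCount.

Variables (F : finFieldType) (K : closedFieldType) (iota : {rmorphism F -> K}).
Local Notation U := {unit F}.
Local Notation N := #|F|.-1.

Lemma card_predK : N.+1 = #|F|.
Proof. by rewrite prednK //; apply/card_gt0P; exists 0. Qed.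

Lemma card_pred_gt0 : (0 < N)%N.
Proof. by rewrite -ltnS card_predK finNzRing_gt1. Qed.

Lemma iota_unit_neq0 (u : U) : iota (val u) != 0.
Proof. by rewrite fmorph_eq0 -unitfE (valP u). Qed.

Lemma pow_neq0 (x : K) (u : U) : x ^+ N = iota (val u) -> x != 0.
Proof.
move=> xE; have := iota_unit_neq0 u; rewrite -xE expf_eq0.
by rewrite card_pred_gt0.
Qed.

Lemma exists_pred_root (a : K) : exists x, x ^+ N = a.
Proof.
have : size ('X^N - a%:P) != 1%N.
  by rewrite size_XnsubC ?card_pred_gt0 // eqSS -lt0n card_pred_gt0.
by move=> /closed_rootP[x]; rewrite rootE !hornerE subr_eq0 => /eqP; exists x.
Qed.

(** Such a [y] is a root of [X^q - X], which splits over [F] as the product of all [X - x]. *)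
Lemma unity_root_iota (y : K) : y ^+ N = 1 -> exists u : U, y = iota (val u).
Proof.
move=> yN; have y_neq0 : y != 0.
  apply: contra_eqN yN => /eqP->.
  by rewrite expr0n gtn_eqF ?card_pred_gt0 // eq_sym oner_eq0.
have : root (map_poly iota ('X^#|F| - 'X)) y.
  rewrite rmorphB /= map_polyXn map_polyX rootE !hornerE -card_predK exprS yN.
  by rewrite mulr1 subrr.
rewrite finField_genPoly rmorph_prod rootE horner_prod.
move=> /prodf_eq0[x _]; rewrite /= map_polyXsubC hornerXsubC subr_eq0.
move=> /eqP yE; have x_unit : x \is a GRing.unit.
  by rewrite unitfE; apply: contraNneq y_neq0 => x0; rewrite yE x0 rmorph0.
by exists (FinRing.unit F x_unit).
Qed.

Variables (I : finType) (X : set {ffun I -> K}) (R : pred {ffun I -> U}).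
Hypothesis X_neq0 : forall P, X P -> forall c, P c != 0.
Hypothesis X_R : forall (P : {ffun I -> K}) (xi : {ffun I -> U}),
  (forall c, P c ^+ N = iota (val (xi c))) -> X P <-> R xi.

Lemma fixed_pow (P : {ffun I -> K}) (xi : {ffun I -> U}) :
  (X P /\ frobenius F P = torus_act iota xi P) <->
  (R xi /\ forall c, P c ^+ N = iota (val (xi c))).
Proof.
split=> [[XP /ffunP fixP]|[Rxi powP]].
  have powP c : P c ^+ N = iota (val (xi c)).
    apply: (mulIf (X_neq0 XP c)).
    by have := fixP c; rewrite !ffunE -card_predK exprSr.
  by split=> //; apply/(X_R powP).
split; first exact/(X_R powP).
by apply/ffunP => c; rewrite !ffunE -card_predK exprSr powP.
Qed.

(* The solutions form a torsor under the torus of rational points. *)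
Lemma card_fixed (xi : {ffun I -> U}) :
  #|` fset_set [set P | X P /\ frobenius F P = torus_act iota xi P]%classic |
  = if R xi then #|{ffun I -> U}| else 0%N.
Proof.
case: ifPn => [Rxi|/negP NRxi]; last first.
  rewrite (_ : [set P | _]%classic = set0) ?fset_set0 ?cardfs0 //.
  by rewrite -subset0 => P /fixed_pow[].
(* A base point of the torsor, chosen coordinatewise by algebraic closedness; [h] is its orbit map,
   injective because the coordinates of [P0] are nonzero. *)
have [P0 P0E] : exists P0 : I -> K, forall c, P0 c ^+ N = iota (val (xi c)).
  by have /fin_all_exists := fun c => exists_pred_root (iota (val (xi c))).
have P0_neq0 c : P0 c != 0 by exact: pow_neq0 (P0E c).
pose h (z : {ffun I -> U}) := torus_act iota z [ffun c => P0 c].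
have h_inj : injective h.
  move=> z z' /ffunP zz'; apply/ffunP => c; have := zz' c; rewrite !ffunE.
  by move=> /(mulIf (P0_neq0 c)) /(fmorph_inj iota) /val_inj.
rewrite (_ : [set P | _]%classic =
  [set` [fset h z | z in {ffun I -> U}]%fset]%classic).
  by rewrite set_fsetK card_imfset //= -cardE.
apply/seteqP; split=> P /=.
  move=> /fixed_pow[_ powP].
  (* The ratio of two solutions is an N-th root of unity, hence rational. *)
  have zP c : exists u : U, P c / P0 c = iota (val u).
    apply: unity_root_iota; rewrite expr_div_n powP P0E divff //.
    exact: iota_unit_neq0.
  have [z zE] := fin_all_exists zP.
  apply/imfsetP; exists [ffun c => z c] => //.
  by apply/ffunP => c; rewrite !ffunE -zE divfK.
move=> /imfsetP[z _ ->]; apply/fixed_pow; split=> // c.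
have unitN (x : F) : x != 0 -> x ^+ N = 1.
  move=> x_neq0; apply: (mulfI x_neq0).
  by rewrite -exprS card_predK mulr1 expf_card.
rewrite !ffunE exprMn P0E -rmorphXn unitN ?rmorph1 ?mul1r //.
by rewrite -unitfE (valP (z c)).
Qed.

(** Each nonempty fibre has as many points as the torus, which cancels the averaging factor in
    [Nchar]. *)
Lemma torusN_sum (chi : I -> mcfun F) :
  torusN iota X chi = \sum_(xi | R xi) torus_char chi xi.
Proof.
rewrite /torusN /Nchar [RHS]big_mkcond mulr_sumr; apply: eq_bigr => xi _.
rewrite card_fixed; case: ifP => _; last by rewrite !mulr0.
rewrite mulrCA mulVf ?mulr1 // pnatr_eq0 -lt0n.
by apply/card_gt0P; exists [ffun=> 1%g].
Qed.

End TorusCount.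

(** * Factorisation of sums over product index sets *)

Section ProductSums.

Variable F : finFieldType.
Local Notation U := {unit F}.

Definition join_ffun (A B : finType) (T : Type) (x : {ffun A -> T})
  (y : {ffun B -> T}) : {ffun A + B -> T} := [ffun c => sumfun x y c].

Lemma sum_join_ffun (A B T : finType) (P : pred {ffun A + B -> T})
    (P1 : pred {ffun A -> T}) (P2 : pred {ffun B -> T})
    (f : {ffun A + B -> T} -> algC) f1 f2 :
  (forall x y, P (join_ffun x y) = P1 x && P2 y) ->
  (forall x y, f (join_ffun x y) = f1 x * f2 y) ->
  \sum_(z | P z) f z = (\sum_(x | P1 x) f1 x) * \sum_(y | P2 y) f2 y.
Proof.
move=> PE fE; rewrite big_distrlr pair_big /=.
rewrite (reindex (fun p => join_ffun p.1 p.2)) /=.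
  by apply: eq_big => [p|p _]; rewrite ?PE ?fE.
exists (fun z : {ffun A + B -> T} =>
  ([ffun a => z (inl a)], [ffun b => z (inr b)])) => [[x y] _|z _] /=.
  by congr (_, _); apply/ffunP => c; rewrite !ffunE.
by apply/ffunP => -[a|b]; rewrite !ffunE /= ffunE.
Qed.

(** The constraints couple only the two coordinates with the same [i], so the sum factors over [i];
    each minus sign is the sign in the definition of a Jacobi sum of two characters. *)
Lemma prod_jacobi2 (I : finType) (a b : I -> mcfun F) :
  \sum_(z : {ffun I + I -> U} |
      [forall i, val (z (inl i)) + val (z (inr i)) == 1])
    (\prod_i a i (z (inl i)) * \prod_i b i (z (inr i)))
  = \prod_i - jacobi2 (a i) (b i).
Proof.
under [RHS]eq_bigr => i _ do rewrite jacobi2E opprK.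
rewrite (bigA_distr_big_dep _ (fun i (p : U * U) => a i p.1 * b i p.2)) /=.
pose h (p : {ffun I -> U * U}) : {ffun I + I -> U} :=
  join_ffun [ffun i => (p i).1] [ffun i => (p i).2].
rewrite (reindex h) /=.
  apply: eq_big => [p|p _].
    by rewrite inE; apply: eq_forallb => i; rewrite !ffunE /= !ffunE.
  by rewrite -big_split; apply: eq_bigr => i _; rewrite !ffunE /= !ffunE.
exists (fun z : {ffun I + I -> U} => [ffun i => (z (inl i), z (inr i))]).
  move=> p _; apply/ffunP => i; rewrite !ffunE /= !ffunE.
  by case: (p i).
by move=> z _; apply/ffunP => -[i|i]; rewrite !ffunE /= !ffunE.
Qed.

End ProductSums.

(** * Jacobi sums of a twisted family of n + 1 characters *)

Section Twists.

Variables (F : finFieldType) (n : nat).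
Local Notation U := {unit F}.

(** The coordinate 0 occurs in every equation with a [lambda_j] and collects a common twist [c],
    later the product of all [nu j]; coordinate [j + 1] occurs in one equation only. *)
Definition twist (alpha : 'I_n.+1 -> mcfun F) (c : mcfun F)
    (nu : 'I_n -> mcfun F) (i : 'I_n.+1) : mcfun F :=
  alpha i * (if unlift ord0 i is Some j then nu j else c).

Lemma twist0 alpha c nu : twist alpha c nu ord0 = alpha ord0 * c.
Proof. by rewrite /twist unlift_none. Qed.

Lemma twistS alpha c nu j :
  twist alpha c nu (lift ord0 j) = alpha (lift ord0 j) * nu j.
Proof. by rewrite /twist liftK. Qed.

Lemma twist_lin alpha c nu i : (forall i, alpha i \is a linear_char) ->
  c \is a linear_char -> (forall j, nu j \is a linear_char) ->
  twist alpha c nu i \is a linear_char.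
Proof. by move=> aL cL nL; rewrite rpredM //; case: unlift. Qed.

Lemma prod_twist alpha c nu (x : 'I_n.+1 -> U) :
  \prod_i twist alpha c nu i (x i) =
  \prod_i alpha i (x i) * (c (x ord0) * \prod_j nu j (x (lift ord0 j))).
Proof.
rewrite !big_ord_recl twist0 cfunE -!mulrA; congr (_ * _).
rewrite mulrCA; congr (_ * _); rewrite -big_split.
by apply: eq_bigr => j _; rewrite twistS cfunE.
Qed.

Variables (psi : 'CF([set: F]%G)).
Hypotheses (psi_lin : psi \is a linear_char) (psi_neq1 : psi != 1).
Variables (alpha : 'I_n.+1 -> mcfun F) (nu : 'I_n -> mcfun F).
Hypothesis alphaL : forall i, alpha i \is a linear_char.
Hypothesis nuL : forall j, nu j \is a linear_char.
Hypothesis prod_alpha_neq1 : \prod_i alpha i != 1.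

(** The twist at 0 cancels those at the other indices, so the product character is unchanged and the
    Gauss sum in the denominator is the same on both sides; [gauss_divr] treats the indices above
    0. *)
Lemma jacobi_twist :
  jacobi (twist alpha (\prod_j nu j) (fun j => (nu j)^-1)) =
  jacobi alpha * (poch psi (alpha ord0) (\prod_j nu j) *
    \prod_j (nu j (unitN1 F) / pocho psi (alpha (lift ord0 j))^-1 (nu j))).
Proof.
set al' := twist _ _ _.
have nuPL : \prod_j nu j \is a linear_char by rewrite rpred_prod.
have al'L i : al' i \is a linear_char.
  by apply: twist_lin => // j; rewrite rpredV; apply: nuL.
have al'P : \prod_i al' i = \prod_i alpha i.
  rewrite !big_ord_recl /al' twist0.
  under [X in _ * X = _]eq_bigr => j _ do rewrite twistS.
  rewrite big_split /= mulrACA -[RHS]mulr1 -!mulrA; congr (_ * (_ * _)).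
  by rewrite -big_split big1 // => j _; rewrite /= lin_char_divrr.
rewrite !(jacobi_gauss psi_lin psi_neq1) ?al'P //.
rewrite mulrAC; congr (_ / _).
rewrite !big_ord_recl /al' twist0.
under [X in _ * X = _]eq_bigr => j _ do
  rewrite twistS (gauss_divr psi_lin psi_neq1) //.
rewrite big_split /= /poch mulrACA; congr (_ * _).
by rewrite mulrCA divff ?mulr1 ?gauss_neq0.
Qed.

End Twists.

(** * Tools common to the three varieties: equations, signs and normalisation *)

Section Assembly.

Variables (F : finFieldType) (psi : 'CF([set: F]%G)).
Hypotheses (psi_lin : psi \is a linear_char) (psi_neq1 : psi != 1).
Variables (K : closedFieldType) (iota : {rmorphism F -> K}).
Variables (n : nat) (lam : 'I_n -> F).
Hypothesis lam_neq0 : forall i, lam i != 0.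

Local Notation U := {unit F}.
Local Notation q := (#|F|%:R : algC).
Local Notation N := #|F|.-1.
Local Notation s i := (lift ord0 i).

Fact lam_unit i : lam i \is a GRing.unit.
Proof. by rewrite unitfE lam_neq0. Qed.

Definition lamu i : U := FinRing.unit F (lam_unit i).

(** Puts an equation [l x y = z w] in the form where a group element equals 1, as character
    orthogonality requires. *)
Definition cross_ratio (l x y z w : U) : U := (l * x * y * (z * w)^-1)%g.

Lemma cross_ratio_eq1 (l x y z w : U) :
  iota (val l) * iota (val x) * iota (val y) = iota (val z) * iota (val w) <->
  cross_ratio l x y z w == 1%g.
Proof.
rewrite -eq_mulgV1 -!rmorphM; split=> [/fmorph_inj e|/eqP/(congr1 val) /= ->//].
exact/eqP/val_inj.
Qed.

Lemma prod_cross_ratio (I : finType) (nu : I -> mcfun F) (l x y z w : I -> U) :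
  (forall i, nu i \is a linear_char) ->
  \prod_i nu i (cross_ratio (l i) (x i) (y i) (z i) (w i)) =
  \prod_i nu i (l i) * (\prod_i nu i (x i) * \prod_i nu i (y i) *
    (\prod_i (nu i)^-1 (z i) * \prod_i (nu i)^-1 (w i))).
Proof.
move=> nuL; rewrite -!big_split; apply: eq_bigr => i _ /=.
rewrite !lin_charMT // lin_charVT // lin_charMT // invfM !lin_char_invE //.
by rewrite !mulrA.
Qed.

(** Compares the normalisation of the Lauricella sums with the factor produced by
    [sum_char_expansion]. *)
Lemma subr1_card : (1 - q) ^- n = (-1) ^+ n * #|{: U}|%:R ^- n :> algC.
Proof.
have -> : 1 - q = - #|{: U}|%:R.
  have := sum_unit (fun _ : F => 1 : algC); rewrite !sumr_const => ->.
  by rewrite opprB.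
by rewrite exprNn invfM -signr_odd; case: odd; rewrite ?invrN1 ?invr1.
Qed.

Lemma sign_sqr : (-1) ^+ n * (-1) ^+ n = 1 :> algC.
Proof. by rewrite -expr2 sqrr_sign. Qed.

Lemma sign_cancel (a b c : algC) :
  (-1) ^+ n * a * b * ((-1) ^+ n * c) = c * (a * b).
Proof.
transitivity ((-1) ^+ n * (-1) ^+ n * (c * (a * b))); first by ring.
by rewrite sign_sqr mul1r.
Qed.

Lemma jsum1E (alpha : 'I_n.+1 -> mcfun F) :
  jsum alpha 1 = (-1) ^+ n * jacobi alpha.
Proof. by rewrite jacobiE signrMK. Qed.

Lemma torus_char_join (A B : finType) (a : A -> mcfun F) (b : B -> mcfun F)
    (x : {ffun A -> U}) (y : {ffun B -> U}) :
  torus_char (sumfun a b) (join_ffun x y) = torus_char a x * torus_char b y.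
Proof.
rewrite /torus_char big_sumType /=.
by congr (_ * _); apply: eq_bigr => c _; rewrite ffunE.
Qed.

Lemma prod_sign_cancel (I : finType) (nu : I -> mcfun F) (a b : I -> algC) :
  (forall i, nu i \is a linear_char) ->
  \prod_i (nu i (unitN1 F) / a i) * \prod_i (nu i (unitN1 F) / b i) =
  (\prod_i (a i * b i))^-1.
Proof.
move=> nuL; rewrite -big_split -prodfV; apply: eq_bigr => i _ /=.
by rewrite mulrACA lin_char_unitN1_sqr // mul1r invfM.
Qed.

(** * The variety for [F_C] *)

Section FC.

Variables alpha beta : 'I_n.+1 -> mcfun F.
Hypothesis alphaL : forall i, alpha i \is a linear_char.
Hypothesis betaL : forall i, beta i \is a linear_char.
Hypothesis alphaP : \prod_i alpha i != 1.
Hypothesis betaP : \prod_i beta i != 1.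

Let u (i : 'I_n) (xi : {ffun 'I_n.+1 + 'I_n.+1 -> U}) : U :=
  cross_ratio (lamu i) (xi (inl ord0)) (xi (inr ord0))
    (xi (inl (s i))) (xi (inr (s i))).

Let C (xi : {ffun 'I_n.+1 + 'I_n.+1 -> U}) : bool :=
  (\sum_i val (xi (inl i)) == 1) && (\sum_i val (xi (inr i)) == 1).

(** The equations involve only N-th powers of coordinates and [iota] is injective, so they descend
    to [xi]: [C] keeps those free of [lambda], [u] the others. Nonvanishing is automatic, as [xi]
    consists of units. *)
Lemma torusN_XFC_sum (chi : 'I_n.+1 + 'I_n.+1 -> mcfun F) :
  torusN iota (XFC iota lam) chi =
  \sum_(xi | C xi && [forall i, u i xi == 1%g]) torus_char chi xi.
Proof.
apply: torusN_sum => [P [_ _ _ /prodf_neq0 PP] c|P xi powP].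
  by case: c => i; have := PP i isT; rewrite mulf_eq0 => /norP[].
have sumE (f : 'I_n.+1 -> 'I_n.+1 + 'I_n.+1) :
    \sum_i P (f i) ^+ N = 1 <-> \sum_i val (xi (f i)) == 1.
  under eq_bigr => i _ do rewrite powP.
  by rewrite -rmorph_sum; split=> [/eqP|/eqP->]; rewrite ?fmorph_eq1 ?rmorph1.
have lamE i : (iota (lam i) * P (inl ord0) ^+ N * P (inr ord0) ^+ N
    = P (inl (s i)) ^+ N * P (inr (s i)) ^+ N) <-> u i xi == 1%g.
  by rewrite !powP; exact: (cross_ratio_eq1 (lamu i)).
split=> [[/sumE xP /sumE yP lamP _]|].
  by rewrite /C xP yP; apply/forallP => i; apply/lamE.
case/andP=> /andP[/sumE xP /sumE yP] /forallP lamP; split=> //.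
  by move=> i; apply/lamE.
by apply/prodf_neq0 => i _; rewrite mulf_neq0 ?(pow_neq0 (powP _)).
Qed.

Lemma torusN_XFC :
  torusN iota (XFC iota lam) (sumfun alpha beta) =
  (-1) ^+ n * jacobi alpha * jacobi beta *
    lauricellaC psi (alpha ord0) (beta ord0)
      (fun i => (alpha (s i))^-1) (fun i => (beta (s i))^-1) lam.
Proof.
rewrite torusN_XFC_sum (sum_char_expansion C u) card_ord.
rewrite /lauricellaC subr1_card [RHS]mulrA.
rewrite sign_cancel -[RHS]mulrA; congr (_ * _).
rewrite mulr_sumr; apply: eq_bigr => k _.
set nu := fun i : 'I_n => 'chi_(k i).
have nuL i : nu i \is a linear_char := irr_unit_lin _.
have CE (x y : {ffun 'I_n.+1 -> U}) : C (join_ffun x y) =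
    (\sum_i val (x i) == 1) && (\sum_i val (y i) == 1).
  rewrite /C; congr (_ && _); congr (_ == _);
    by apply: eq_bigr => i _; rewrite ffunE.
(* Both coordinates of index 0 lie on the left of every equation and those of index [j + 1] on the
   right, so both families receive the same twist. *)
pose tw a := twist a (\prod_j nu j) (fun j => (nu j)^-1).
have fE (x y : {ffun 'I_n.+1 -> U}) :
    torus_char (sumfun alpha beta) (join_ffun x y)
      * \prod_i nu i (u i (join_ffun x y))
    = (\prod_i nu i (lamu i) * \prod_i tw alpha i (x i))
      * \prod_i tw beta i (y i).
  rewrite torus_char_join; under eq_bigr => i _ do rewrite /u !ffunE /=.
  rewrite prod_cross_ratio // !prod_twist !prod_cfunE ?inE //.
  by rewrite /torus_char; ring.
rewrite (sum_join_ffun CE fE).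
rewrite -mulr_sumr -/(jsum _ _) -/(jsum _ _) !jsum1E !(jacobi_twist psi_lin) //.
rewrite -(prod_sign_cancel _ _ nuL).
under [X in _ = _ * (_ * X)]eq_bigr => i _ do
  rewrite (mchar_extE _ (lam_unit i)) -/(lamu i) -/(nu i).
(* The two sums over hyperplanes each contribute [(-1)^n] through [jsum1E]. *)
by rewrite -[RHS]mul1r -[X in _ = X * _]sign_sqr; ring.
Qed.

End FC.

(** * The variety for [F_A] *)

Section FA.

Variables (alpha : 'I_n.+1 -> mcfun F) (beta gamma : 'I_n -> mcfun F).
Hypothesis alphaL : forall i, alpha i \is a linear_char.
Hypothesis betaL : forall i, beta i \is a linear_char.
Hypothesis gammaL : forall i, gamma i \is a linear_char.
Hypothesis alphaP : \prod_i alpha i != 1.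
Hypothesis beta_gamma_neq1 : forall i, beta i * gamma i != 1.

Let u (i : 'I_n) (xi : {ffun 'I_n.+1 + ('I_n + 'I_n) -> U}) : U :=
  cross_ratio (lamu i) (xi (inl ord0)) (xi (inr (inl i)))
    (xi (inl (s i))) (xi (inr (inr i))).

Let C (xi : {ffun 'I_n.+1 + ('I_n + 'I_n) -> U}) : bool :=
  (\sum_i val (xi (inl i)) == 1) &&
  [forall i, val (xi (inr (inl i))) + val (xi (inr (inr i))) == 1].

Lemma torusN_XFA_sum (chi : 'I_n.+1 + ('I_n + 'I_n) -> mcfun F) :
  torusN iota (XFA iota lam) chi =
  \sum_(xi | C xi && [forall i, u i xi == 1%g]) torus_char chi xi.
Proof.
apply: torusN_sum => [P [_ _ _ ] |P xi powP].
  rewrite mulf_eq0 => /norP[/prodf_neq0 PP /prodf_neq0 QP] [i|[i|i]].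
  - exact: PP.
  - by have := QP i isT; rewrite mulf_eq0 => /norP[].
  - by have := QP i isT; rewrite mulf_eq0 => /norP[].
have sumE : \sum_i P (inl i) ^+ N = 1 <-> \sum_i val (xi (inl i)) == 1.
  under eq_bigr => i _ do rewrite powP.
  by rewrite -rmorph_sum; split=> [/eqP|/eqP->]; rewrite ?fmorph_eq1 ?rmorph1.
have addE i : P (inr (inl i)) ^+ N + P (inr (inr i)) ^+ N = 1 <->
    val (xi (inr (inl i))) + val (xi (inr (inr i))) == 1.
  rewrite !powP -rmorphD.
  by split=> [/eqP|/eqP->]; rewrite ?fmorph_eq1 ?rmorph1.
have lamE i : (iota (lam i) * P (inl ord0) ^+ N * P (inr (inl i)) ^+ N
    = P (inl (s i)) ^+ N * P (inr (inr i)) ^+ N) <-> u i xi == 1%g.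
  by rewrite !powP; exact: (cross_ratio_eq1 (lamu i)).
split=> [[/sumE xP yzP lamP _]|].
  rewrite /C xP /=; apply/andP; split; apply/forallP => i; last exact/lamE.
  exact/addE.
case/andP=> /andP[/sumE xP /forallP yzP] /forallP lamP; split=> //.
- by move=> i; apply/addE.
- by move=> i; apply/lamE.
rewrite mulf_neq0 //; apply/prodf_neq0 => i _; rewrite ?mulf_neq0 //;
  exact: (pow_neq0 (powP _)).
Qed.

Lemma torusN_XFA :
  torusN iota (XFA iota lam) (sumfun alpha (sumfun beta gamma)) =
  (-1) ^+ n * jacobi alpha * (\prod_i jacobi2 (beta i) (gamma i)) *
    lauricellaA psi (alpha ord0) beta
      (fun i => (alpha (s i))^-1) (fun i => (gamma i)^-1) lam.
Proof.
rewrite torusN_XFA_sum (sum_char_expansion C u) card_ord.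
rewrite /lauricellaA subr1_card [RHS]mulrA.
rewrite sign_cancel -[RHS]mulrA; congr (_ * _).
rewrite mulr_sumr; apply: eq_bigr => k _.
set nu := fun i : 'I_n => 'chi_(k i).
have nuL i : nu i \is a linear_char := irr_unit_lin _.
have CE (x : {ffun 'I_n.+1 -> U}) (y : {ffun 'I_n + 'I_n -> U}) :
    C (join_ffun x y) =
    (\sum_i val (x i) == 1) &&
    [forall i, val (y (inl i)) + val (y (inr i)) == 1].
  rewrite /C; congr (_ && _); last by apply: eq_forallb => i; rewrite !ffunE.
  by congr (_ == _); apply: eq_bigr => i _; rewrite ffunE.
pose tw := twist alpha (\prod_j nu j) (fun j => (nu j)^-1).
have fE (x : {ffun 'I_n.+1 -> U}) (y : {ffun 'I_n + 'I_n -> U}) :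
    torus_char (sumfun alpha (sumfun beta gamma)) (join_ffun x y)
      * \prod_i nu i (u i (join_ffun x y))
    = (\prod_i nu i (lamu i) * \prod_i tw i (x i))
      * (\prod_i (beta i * nu i) (y (inl i))
         * \prod_i (gamma i * (nu i)^-1) (y (inr i))).
  rewrite torus_char_join; under eq_bigr => i _ do rewrite /u !ffunE /=.
  rewrite prod_cross_ratio // prod_twist prod_cfunE ?inE //.
  under [X in _ = _ * (X * _)]eq_bigr => i _ do rewrite cfunE.
  under [X in _ = _ * (_ * X)]eq_bigr => i _ do rewrite cfunE.
  by rewrite /torus_char big_sumType /= !big_split /=; ring.
(* The constraint splits into one hyperplane for [x] and [n] lines for the pairs [(y_i, z_i)]; the
   latter give the Jacobi sums of [beta i] and [gamma i] with opposite twists. *)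
rewrite (sum_join_ffun CE fE) prod_jacobi2 (prod_jacobi2_twist psi_lin) //.
rewrite -mulr_sumr -/(jsum _ _) jsum1E (jacobi_twist psi_lin) // card_ord.
rewrite -(prod_sign_cancel _ _ nuL).
under [X in _ = _ * (_ * X)]eq_bigr => i _ do
  rewrite (mchar_extE _ (lam_unit i)) -/(lamu i) -/(nu i).
by rewrite -[RHS]mul1r -[X in _ = X * _]sign_sqr; ring.
Qed.

End FA.

(** * The variety for [F_D] *)

Section FD.

Variables alpha beta : 'I_n.+1 -> mcfun F.
Hypothesis alphaL : forall i, alpha i \is a linear_char.
Hypothesis betaL : forall i, beta i \is a linear_char.
Hypothesis alpha_beta_neq1 : forall i, alpha i * beta i != 1.

Let u (i : 'I_n) (xi : {ffun 'I_n.+1 + 'I_n.+1 -> U}) : U :=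
  cross_ratio (lamu i) (xi (inl ord0)) (xi (inl (s i)))
    (xi (inr ord0)) (xi (inr (s i))).

Let C (xi : {ffun 'I_n.+1 + 'I_n.+1 -> U}) : bool :=
  [forall i, val (xi (inl i)) + val (xi (inr i)) == 1].

Lemma torusN_XFD_sum (chi : 'I_n.+1 + 'I_n.+1 -> mcfun F) :
  torusN iota (XFD iota lam) chi =
  \sum_(xi | C xi && [forall i, u i xi == 1%g]) torus_char chi xi.
Proof.
apply: torusN_sum => [P [_ _ /prodf_neq0 PP] c|P xi powP].
  by case: c => i; have := PP i isT; rewrite mulf_eq0 => /norP[].
have addE i : P (inl i) ^+ N + P (inr i) ^+ N = 1 <->
    val (xi (inl i)) + val (xi (inr i)) == 1.
  rewrite !powP -rmorphD.
  by split=> [/eqP|/eqP->]; rewrite ?fmorph_eq1 ?rmorph1.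
have lamE i : (iota (lam i) * P (inl ord0) ^+ N * P (inl (s i)) ^+ N
    = P (inr ord0) ^+ N * P (inr (s i)) ^+ N) <-> u i xi == 1%g.
  by rewrite !powP; exact: (cross_ratio_eq1 (lamu i)).
split=> [[xyP lamP _]|].
  apply/andP; split; apply/forallP => i; last exact/lamE.
  exact/addE.
case/andP=> /forallP xyP /forallP lamP; split=> //.
- by move=> i; apply/addE.
- by move=> i; apply/lamE.
by apply/prodf_neq0 => i _; rewrite mulf_neq0 ?(pow_neq0 (powP _)).
Qed.

Lemma torusN_XFD :
  torusN iota (XFD iota lam) (sumfun alpha beta) =
  - (\prod_i jacobi2 (alpha i) (beta i)) *
    lauricellaD psi (alpha ord0) (fun i => alpha (s i))
      (beta ord0)^-1 (fun i => (beta (s i))^-1) lam.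
Proof.
rewrite torusN_XFD_sum (sum_char_expansion C u) card_ord.
have mulrACB (a b c d : algC) : a * (b * c * d) = c * (b * a * d) by ring.
rewrite /lauricellaD subr1_card mulrACB; congr (_ * _).
rewrite !mulr_sumr; apply: eq_bigr => k _.
set nu := fun i : 'I_n => 'chi_(k i).
have nuL i : nu i \is a linear_char := irr_unit_lin _.
(* All n + 1 pairs [(x_i, y_i)] are twisted oppositely, by [nu' i] and its inverse; the pair of
   index 0 meets every equation and gets the product of all [nu j]. *)
pose nu' (i : 'I_n.+1) :=
  if unlift ord0 i is Some j then nu j else \prod_j nu j.
have nu'0 : nu' ord0 = \prod_j nu j by rewrite /nu' unlift_none.
have nu'S j : nu' (s j) = nu j by rewrite /nu' liftK.
have nuPL : \prod_j nu j \is a linear_char by rewrite rpred_prod.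
have nu'L i : nu' i \is a linear_char by rewrite /nu'; case: unlift.
have fE (xi : {ffun 'I_n.+1 + 'I_n.+1 -> U}) :
    torus_char (sumfun alpha beta) xi * \prod_i nu i (u i xi)
    = \prod_i nu i (lamu i) * (\prod_i (alpha i * nu' i) (xi (inl i))
         * \prod_i (beta i * (nu' i)^-1) (xi (inr i))).
  rewrite prod_cross_ratio //.
  under [X in _ = _ * (X * _)]eq_bigr => i _ do rewrite cfunE.
  under [X in _ = _ * (_ * X)]eq_bigr => i _ do rewrite cfunE.
  rewrite /torus_char big_sumType /= !big_split /=.
  rewrite [\prod_i nu' i _]big_ord_recl [\prod_i (nu' i)^-1 _]big_ord_recl.
  rewrite nu'0 (lin_char_invE _ nuPL) !prod_cfunE ?inE // -prodfV.
  under [X in _ = _ * (_ * (_ * X) * _)]eq_bigr => i _ do rewrite nu'S.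
  under [X in _ = _ * (_ * (_ * (_ * X)))]eq_bigr => i _ do rewrite nu'S.
  under [X in _ * (_ * (_ * _ * (X * _))) = _]eq_bigr => i _ do
    rewrite lin_char_invE //.
  by ring.
rewrite (eq_bigr _ (fun xi _ => fE xi)).
rewrite -mulr_sumr prod_jacobi2 (prod_jacobi2_twist psi_lin) // card_ord.
rewrite [\prod_i poch _ _ (nu' i)]big_ord_recl.
rewrite [\prod_i (nu' i _ / _)]big_ord_recl.
rewrite !nu'0 prod_cfunE ?inE //.
under [X in _ * (_ * (_ * (_ * X * _))) = _]eq_bigr => i _ do rewrite nu'S.
under [X in _ * (_ * (_ * (_ * (_ * X)))) = _]eq_bigr => i _ do rewrite nu'S.
under [X in _ = _ * (_ * X)]eq_bigr => i _ do
  rewrite (mchar_extE _ (lam_unit i)) -/(lamu i) -/(nu i).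
(* One factor is the sign from the pair of index 0, the other collects the signs from the remaining
   pairs. *)
have sign2 : \prod_i nu i (unitN1 F) * \prod_i nu i (unitN1 F) = 1.
  rewrite -big_split big1 // => i _.
  by rewrite /= lin_char_unitN1_sqr.
rewrite [\prod_i (nu i _ / _)]big_split prodfV /= [_ / _ * (_ / _)]mulrACA.
(* The n + 1 Jacobi sums give [(-1)^(n+1)] against [(-1)^n] from the normalisation, whence the
   leading minus sign. *)
by rewrite sign2 mul1r -invfM exprS; ring.
Qed.

End FD.

End Assembly.

Theorem theorem4p10 (F : finFieldType) (psi : 'CF([set: F]%G))
    (psi_char : psi \is a linear_char) (psi_neq1 : psi <> 1)
    (K : closedFieldType) (iota : {rmorphism F -> K})
    (K_alg : integralRange iota)
    (n : nat) (n_gt0 : (0 < n)%N)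
    (lam : 'I_n -> F) (lam_neq0 : forall i, lam i <> 0) :
  (forall alpha beta : 'I_n.+1 -> mcfun F,
     (forall i, alpha i \is a linear_char) ->
     (forall i, beta i \is a linear_char) ->
     (forall i, alpha i * beta i <> 1) ->
     torusN iota (XFD iota lam) (sumfun alpha beta) =
     - (\prod_i jacobi2 (alpha i) (beta i)) *
       lauricellaD psi (alpha ord0) (fun i => alpha (lift ord0 i))
         (beta ord0)^-1 (fun i => (beta (lift ord0 i))^-1) lam)
  /\
  (forall (alpha : 'I_n.+1 -> mcfun F) (beta gamma : 'I_n -> mcfun F),
     (forall i, alpha i \is a linear_char) ->
     (forall i, beta i \is a linear_char) ->
     (forall i, gamma i \is a linear_char) ->
     \prod_i alpha i <> 1 ->
     (forall i, beta i * gamma i <> 1) ->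
     torusN iota (XFA iota lam) (sumfun alpha (sumfun beta gamma)) =
     (-1) ^+ n * jacobi alpha * (\prod_i jacobi2 (beta i) (gamma i)) *
       lauricellaA psi (alpha ord0) beta
         (fun i => (alpha (lift ord0 i))^-1) (fun i => (gamma i)^-1) lam)
  /\
  (forall alpha beta : 'I_n.+1 -> mcfun F,
     (forall i, alpha i \is a linear_char) ->
     (forall i, beta i \is a linear_char) ->
     \prod_i alpha i <> 1 ->
     \prod_i beta i <> 1 ->
     torusN iota (XFC iota lam) (sumfun alpha beta) =
     (-1) ^+ n * jacobi alpha * jacobi beta *
       lauricellaC psi (alpha ord0) (beta ord0)
         (fun i => (alpha (lift ord0 i))^-1)
         (fun i => (beta (lift ord0 i))^-1) lam).
Proof.
have psi1 : psi != 1 by apply/eqP.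
have lam0 i : lam i != 0 by apply/eqP/lam_neq0.
split=> [alpha beta aL bL ab|].
  by apply: torusN_XFD => // i; apply/eqP/ab.
split=> [alpha beta gamma aL bL cL aP bc|alpha beta aL bL aP bP].
  by apply: torusN_XFA => // [|i]; apply/eqP; [exact: aP|exact: bc].
by apply: torusN_XFC => //; apply/eqP.
Qed.
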